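(* Let $X$ be a nonempty set, $(Y,\leq)$ a partially ordered set, $\Gamma$ a nonempty set, $n:\Gamma\to\mathbb{N}$ a function, and let $\omega=\{\omega_\gamma:X^{n(\gamma)}\to X\mid\gamma\in\Gamma\}$ and $\Omega=\{\Omega_\gamma:Y^{n(\gamma)}\to Y\mid\gamma\in\Gamma\}$ be two families of operations. Assume that: (1) $(Y,\leq)$ is lower chain-complete; (2) the family $\omega$ consists of reflexive and pairwise mutually distributive operations; (3) the family $\Omega$ consists of reflexive and pairwise mutually distributive operations such that, for all $\gamma\in\Gamma$, the operation $\Omega_\gamma$ is an order automorphism of $Y$ in each of its variables. Let $f:X\to Y$ be an $(\omega,\Omega)$-convex function. Then, for every point $p\in\operatorname{int}_\omega(X)$, there exists an $(\omega,\Omega)$-affine function $g:X\to Y$ such that $g\leq f$ (pointwise) and $g(p)=f(p)$.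
   Context: $\mathbb{N}$ denotes the positive integers. Lower chain-complete: every nonempty chain (totally ordered subset) of $Y$ that is bounded below has an infimum in $Y$. Pairwise mutually distributive: a family $\omega=\{\omega_\gamma:X^{n(\gamma)}\to X\mid\gamma\in\Gamma\}$ has this property if for all $\gamma,\beta\in\Gamma$, all $k\in\{1,\dots,n(\gamma)\}$ and all $x_1,\dots,x_{k-1},x_{k+1},\dots,x_{n(\gamma)},y_1,\dots,y_{n(\beta)}\in X$, $$\omega_{\gamma}(x_1,\dots,x_{k-1},\omega_{\beta}(y_1,\dots,y_{n(\beta)}),x_{k+1},\dots,x_{n(\gamma)})=\omega_{\beta}\big(z_1,\dots,z_{n(\beta)}\big),$$ where $z_j=\omega_{\gamma}(x_1,\dots,x_{k-1},y_j,x_{k+1},\dots,x_{n(\gamma)})$. (Same definition for $\Omega$ on $Y$.) Reflexive: $\omega_\gamma(x,\dots,x)=x$ for all $\gamma\in\Gamma$ and all $x\in X$ (and similarly for $\Omega$ on $Y$). Order automorphism of $Y$: a bijection $\Phi:Y\to Y$ with $y_1\leq y_2\iff\Phi(y_1)\leq\Phi(y_2)$. $\Omega_\gamma$ is an order automorphism in each of its variables if for each index $i$ and each choice of the other arguments, the map $y\mapsto\Omega_\gamma(y_1,\dots,y_{i-1},y,y_{i+1},\dots,y_{n(\gamma)})$ is an order automorphism of $Y$. A set $E\subseteq X$ is $\omega$-extreme if $\omega_\gamma^{-1}(E)\subseteq E^{n(\gamma)}$ for all $\gamma\in\Gamma$ (i.e. $\omega_\gamma(x_1,\dots,x_{n(\gamma)})\in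 E$ implies all $x_i\in E$). The $\omega$-extreme hull $\operatorname{ext}_\omega(H)$ of $H\subseteq X$ is the intersection of all $\omega$-extreme subsets of $X$ containing $H$. The $\omega$-interior is $\operatorname{int}_\omega(X)=\{p\in X\mid\operatorname{ext}_\omega(\{p\})=X\}$. A function $f:X\to Y$ is $(\omega,\Omega)$-convex if $f(\omega_\gamma(x_1,\dots,x_{n(\gamma)}))\leq\Omega_\gamma(f(x_1),\dots,f(x_{n(\gamma)}))$ for all $\gamma\in\Gamma$ and $x_1,\dots,x_{n(\gamma)}\in X$; it is $(\omega,\Omega)$-affine if equality always holds. *)

(* Defs.v *)
From mathcomp Require Import all_boot all_order.
From mathcomp Require Import boolp classical_sets.

Set Implicit Arguments.
Unset Strict Implicit.
Unset Printing Implicit Defensive.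

Local Open Scope classical_set_scope.
Local Open Scope order_scope.

(* An element (x_1, ..., x_n) of T^n is a function 'I_n -> T. *)
Definition op_family (Gamma : Type) (n : Gamma -> nat) (T : Type) :=
  forall gamma : Gamma, ('I_(n gamma) -> T) -> T.

(* (x_1, ..., x_{k-1}, y, x_{k+1}, ..., x_n): the k-th entry of x is ignored. *)
Definition subst_at (T : Type) (n : nat) (x : 'I_n -> T) (k : 'I_n) (y : T) :
    'I_n -> T :=
  fun i => if i == k then y else x i.

Definition lower_chain_complete (d : Order.disp_t) (Y : porderType d) : Prop :=
  forall C : set Y, C !=set0 -> total_on C (fun x y => x <= y) ->
    has_lbound C -> infimums C !=set0.

Definition order_automorphism (d : Order.disp_t) (Y : porderType d)
    (Phi : Y -> Y) : Prop :=
  bijective Phi /\ forall y1 y2 : Y, y1 <= y2 <-> Phi y1 <= Phi y2.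

Definition mutually_distributive (Gamma : Type) (n : Gamma -> nat) (T : Type)
    (omega : op_family n T) : Prop :=
  forall (gamma beta : Gamma) (k : 'I_(n gamma))
         (x : 'I_(n gamma) -> T) (y : 'I_(n beta) -> T),
    omega gamma (subst_at x k (omega beta y)) =
    omega beta (fun j => omega gamma (subst_at x k (y j))).

Definition reflexive_ops (Gamma : Type) (n : Gamma -> nat) (T : Type)
    (omega : op_family n T) : Prop :=
  forall (gamma : Gamma) (x : T), omega gamma (fun=> x) = x.

Definition extreme (Gamma : Type) (n : Gamma -> nat) (T : Type)
    (omega : op_family n T) (E : set T) : Prop :=
  forall gamma : Gamma,
    omega gamma @^-1` E `<=` [set x | forall i, E (x i)].

Definition extreme_hull (Gamma : Type) (n : Gamma -> nat) (T : Type)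
    (omega : op_family n T) (H : set T) : set T :=
  smallest (extreme omega) H.

Definition op_interior (Gamma : Type) (n : Gamma -> nat) (T : Type)
    (omega : op_family n T) : set T :=
  [set p | extreme_hull omega [set p] = setT].

Definition automorphism_in_each_variable (Gamma : Type) (n : Gamma -> nat)
    (d : Order.disp_t) (Y : porderType d) (Omega : op_family n Y) : Prop :=
  forall (gamma : Gamma) (i : 'I_(n gamma)) (y : 'I_(n gamma) -> Y),
    order_automorphism (fun t => Omega gamma (subst_at y i t)).

Definition op_convex (Gamma : Type) (n : Gamma -> nat) (X : Type)
    (d : Order.disp_t) (Y : porderType d)
    (omega : op_family n X) (Omega : op_family n Y) (f : X -> Y) : Prop :=
  forall (gamma : Gamma) (x : 'I_(n gamma) -> X),
    f (omega gamma x) <= Omega gamma (fun i => f (x i)).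

Definition op_affine (Gamma : Type) (n : Gamma -> nat) (X : Type) (Y : Type)
    (omega : op_family n X) (Omega : op_family n Y) (f : X -> Y) : Prop :=
  forall (gamma : Gamma) (x : 'I_(n gamma) -> X),
    f (omega gamma x) = Omega gamma (fun i => f (x i)).

(* Main.v *)
(* A minimal element g, given by Zorn's lemma, among the convex functions below
   f that agree with f at p is affine.  Values at points of the interior cannot
   decrease indefinitely along such functions, because the set of points where
   they have a common lower bound is extreme and contains p; so chains have
   pointwise infima.  For the affinity of g, fix all arguments of an operation
   but one, which yields endomorphisms T of X and S of Y with S invertible, and
   g' = S^-1 o g o T is again convex and below g.  If g' p = g p, minimality
   gives g o T = S o g.  This turns "g commutes with omega_gamma when the k-th
   argument is p" into "g commutes with omega_gamma for every k-th argument",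
   so the arguments can be freed one after the other, starting from
   (p, ..., p). *)
Require Import Defs.
From mathcomp Require Import all_boot all_order.
From mathcomp Require Import boolp classical_sets.

Set Implicit Arguments.
Unset Strict Implicit.
Unset Printing Implicit Defensive.

Import Order.TTheory.
Local Open Scope classical_set_scope.
Local Open Scope order_scope.

Lemma subst_at_id (T : Type) (n : nat) (x : 'I_n -> T) (k : 'I_n) :
  subst_at x k (x k) = x.
Proof. by apply/funext => i; rewrite /subst_at; case: eqP => [->|]. Qed.

Lemma comp_subst_at (T U : Type) (h : T -> U) (n : nat) (x : 'I_n -> T)
    (k : 'I_n) (t : T) :
  (fun i => h (subst_at x k t i)) = subst_at (fun i => h (x i)) k (h t).
Proof. by apply/funext => i; rewrite /subst_at; case: eqP. Qed.

(** Entries are exchanged for those of [z] one index at a time, starting from a tuple with entries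
    in the sets [C i]. In the second premise [u] is arbitrary, since it may mix old and new
    entries. *)
Lemma coordinatewise_ind (T : Type) (n : nat) (C : 'I_n -> set T)
    (z : 'I_n -> T) (P : ('I_n -> T) -> Prop) :
  (forall u, (forall i, C i (u i)) -> P u) ->
  (forall k u, (forall t, C k t -> P (subst_at u k t)) ->
     P (subst_at u k (z k))) ->
  P z.
Proof.
move=> P_C P_subst.
(* Invariant: the entries with index below [m] are already those of [z], and the others still lie in
   [C]. *)
suff freed m u : (forall i : 'I_n, m <= i -> C i (u i))%N ->
    (forall i : 'I_n, i < m -> u i = z i)%N -> P u.
  by apply: (freed n) => // i; rewrite leqNgt ltn_ord.
elim: m u => [|m IHm] u u_C u_z; first by apply: P_C => i; apply: u_C.
have [lt_mn|le_nm] := ltnP m n; last first.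
  apply: IHm => i hi; last by apply: u_z; rewrite ltnW.
  by have := leq_trans le_nm hi; rewrite leqNgt ltn_ord.
pose k := Ordinal lt_mn.
rewrite -(subst_at_id u k) (u_z k) //; apply: P_subst => t Ct.
apply: IHm => i hi; rewrite /subst_at; case: (eqVneq i k) => [ik|ne_ik].
- by rewrite ik.
- by apply: u_C; rewrite ltn_neqAle hi andbT eq_sym.
- by move: hi; rewrite ik ltnn.
- by apply: u_z; rewrite ltnW.
Qed.

(** The preimage of [b] under [Phi] is a lower bound of [C], hence lies below [z]. *)
Lemma automorphism_le_inf (d : Order.disp_t) (Y : porderType d) (Phi : Y -> Y)
    (C : set Y) (b z : Y) :
  order_automorphism Phi -> infimums C z ->
  (forall t, C t -> b <= Phi t) -> b <= Phi z.
Proof.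
move=> [[Psi PhiK PsiK] Phi_mono] [_ z_max] b_lb.
rewrite -(PsiK b); apply/(Phi_mono _ _).1; apply: z_max => t Ct.
by apply/Phi_mono; rewrite PsiK; exact: b_lb.
Qed.

Section Operations.
Context (Gamma : Type) (n : Gamma -> nat) (X : Type).
Context (d : Order.disp_t) (Y : porderType d).
Context (omega : op_family n X) (Omega : op_family n Y).
Arguments omega : clear implicits.
Arguments Omega : clear implicits.
Hypothesis Omega_aut : automorphism_in_each_variable Omega.

Lemma op_mono gamma (u v : 'I_(n gamma) -> Y) :
  (forall i, u i <= v i) -> Omega gamma u <= Omega gamma v.
Proof.
move=> le_uv.
apply: (@coordinatewise_ind _ _ (fun i => [set u i]) v
  (fun w => Omega gamma u <= Omega gamma w)) => [w w_u|k w le_w].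
  by have -> : w = u by apply/funext.
exact: le_trans (le_w _ erefl) (((Omega_aut k w).2 _ _).1 (le_uv k)).
Qed.

(** Each variable in turn passes to its infimum, the others being fixed. *)
Lemma op_le_inf gamma (C : 'I_(n gamma) -> set Y) (b : Y)
    (z : 'I_(n gamma) -> Y) :
  (forall i, infimums (C i) (z i)) ->
  (forall u, (forall i, C i (u i)) -> b <= Omega gamma u) ->
  b <= Omega gamma z.
Proof.
move=> z_inf b_lb.
apply: (coordinatewise_ind (P := fun w => b <= Omega gamma w) b_lb) => k u.
exact: (automorphism_le_inf (Omega_aut k u) (z_inf k)).
Qed.

Lemma chain_inf_convex (A : set (X -> Y)) (G : X -> Y) :
  A !=set0 -> total_on A (fun g h => forall x, g x <= h x) ->
  (forall g, A g -> op_convex omega Omega g) ->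
  (forall x, infimums [set g x | g in A] (G x)) ->
  op_convex omega Omega G.
Proof.
move=> [g0 Ag0] A_total A_convex G_inf gamma x.
apply: (op_le_inf (fun i => G_inf (x i))) => u u_A.
(* The values [u i] may come from different members of [A]. Since [A] is a chain and the indices are
   finitely many, one member lies below all of them. *)
have [g Ag g_le] : exists2 g, A g & forall i, i \in enum 'I_(n gamma) ->
    g (x i) <= u i.
  elim: (enum _) => [|i s [g Ag g_le]]; first by exists g0.
  have [h Ah h_u] := u_A i.
  have [le_gh|le_hg] := A_total _ _ Ag Ah.
    exists g => // j; rewrite inE => /predU1P[->|]; last exact: g_le.
    by rewrite -h_u.
  exists h => // j; rewrite inE => /predU1P[->|js]; first by rewrite h_u.
  exact: le_trans (g_le _ js).
apply: (@le_trans _ _ (g (omega gamma x))).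
  by apply: (G_inf _).1; exists g.
apply: (le_trans (A_convex _ Ag _ _)); apply: op_mono => i.
by apply: g_le; rewrite mem_enum.
Qed.

Section Minorants.
Context (f : X -> Y) (p : X).

Definition convex_minorant_at (g : X -> Y) : Prop :=
  [/\ op_convex omega Omega g, forall x, g x <= f x & g p = f p].

Lemma convex_minorants_lbound : op_interior omega p ->
  forall x, has_lbound [set g x | g in convex_minorant_at].
Proof.
move=> p_int.
pose E := [set x | has_lbound [set g x | g in convex_minorant_at]].
suff hull_E : extreme_hull omega [set p] `<=` E.
  by move=> x; apply: hull_E; rewrite p_int.
apply: smallest_sub => [gamma x [b b_lb] i|_ ->]; last first.
  by exists (f p) => _ [g [_ _ ->] <-].
(* By convexity and [g <= f], the bound [b] lies below the operation applied to [g (x i)] at [i] and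
   [f (x j)] elsewhere. Inverting in the variable [i] gives a bound on [g (x i)] independent of
   [g]. *)
have [[Psi _ PsiK] mono] := Omega_aut i (fun j => f (x j)).
exists (Psi b) => _ [g [g_convex g_f g_p] <-].
apply/mono; rewrite PsiK.
apply: (@le_trans _ _ (g (omega gamma x))); first by apply: b_lb; exists g.
apply: (le_trans (g_convex _ _)); apply: op_mono => j.
by rewrite /subst_at; case: eqP => [->|].
Qed.

Lemma minimal_convex_minorant :
  lower_chain_complete Y -> op_convex omega Omega f -> op_interior omega p ->
  exists2 g, convex_minorant_at g &
    forall h, convex_minorant_at h -> (forall x, h x <= g x) -> h = g.
Proof.
move=> Y_complete f_convex p_int.
pose M := {g : X -> Y | convex_minorant_at g}.
(* The order is reversed, so that a maximal element is a minimal function. *)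
pose R (g h : M) := `[< forall x, sval h x <= sval g x >].
have [||||[g g_min] g_minimal] := @Zorn M R.
- by move=> g; apply/asboolP => x.
- move=> g h k /asboolP gh /asboolP hk; apply/asboolP => x.
  exact: le_trans (hk x) (gh x).
- move=> [g g_min] [h h_min] /asboolP gh /asboolP hg.
  apply: eq_exist; apply/funext => x.
  by apply/eqP; rewrite eq_le gh hg.
- move=> A A_total.
  have [[g0 Ag0]|A0] := pselect (A !=set0); last first.
    (* Any element of [M] bounds the empty chain. *)
    exists (exist _ f (And3 f_convex (fun=> lexx _) erefl)) => g Ag.
    by case: A0; exists g.
  pose B := [set sval g | g in A].
  have B_total : total_on B (fun g h => forall x, g x <= h x).
    move=> _ _ [g Ag <-] [h Ah <-].
    by have [/asboolP|/asboolP] := A_total _ _ Ag Ah; [right|left].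
  have B_min g : B g -> convex_minorant_at g.
    by move=> [h _ <-]; exact: (svalP h).
  have B0 : B (sval g0) by exists g0.
  have /choice[G G_inf] x : exists y, infimums [set g x | g in B] y.
    apply: Y_complete; first by exists (sval g0 x); exists (sval g0).
      move=> _ _ [g Bg <-] [h Bh <-].
      by have [] := B_total _ _ Bg Bh => le_gh; [left|right].
    have [b b_lb] := convex_minorants_lbound p_int x.
    by exists b => _ [g Bg <-]; apply: b_lb; exists g => //; exact: B_min.
  have G_le g x : B g -> G x <= g x.
    by move=> Bg; apply: (G_inf x).1; exists g.
  have G_min : convex_minorant_at G.
    split=> [|x|].
    + apply: (@chain_inf_convex B) => //; first by exists (sval g0).
      by move=> g /B_min[].
    + by apply: le_trans (G_le _ x B0) _; have [] := B_min _ B0.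
    + apply/eqP; rewrite eq_le; apply/andP; split.
        by have [_ _ <-] := B_min _ B0; exact: G_le.
      by apply: (G_inf p).2 => _ [g /B_min[_ _ ->] <-].
  by exists (exist _ G G_min) => g Ag; apply/asboolP => x; apply: G_le; exists g.
exists g => // h h_min le_hg.
by have /(congr1 sval) := g_minimal (exist _ h h_min) (asboolT le_hg).
Qed.

Lemma minimal_convex_minorant_affine (g : X -> Y) :
  reflexive_ops omega -> mutually_distributive omega ->
  reflexive_ops Omega -> mutually_distributive Omega ->
  convex_minorant_at g ->
  (forall h, convex_minorant_at h -> (forall x, h x <= g x) -> h = g) ->
  op_affine omega Omega g.
Proof.
move=> omega_refl omega_distr Omega_refl Omega_distr [g_convex g_f g_p] g_min.
move=> gamma x.
apply: (@coordinatewise_ind _ _ (fun=> [set p]) x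
  (fun w => g (omega gamma w) = Omega gamma (fun i => g (w i)))).
  move=> u u_p; have -> : u = fun=> p by apply/funext.
  by rewrite omega_refl Omega_refl.
move=> k a /(_ _ erefl); rewrite !comp_subst_at.
pose T t := omega gamma (subst_at a k t).
pose S t := Omega gamma (subst_at (fun i => g (a i)) k t).
rewrite -/(T p) -/(S (g p)) -/(T (x k)) -/(S (g (x k))) => gTp.
have [[Sinv SK SinvK] S_mono] : order_automorphism S := Omega_aut k _.
pose h t := Sinv (g (T t)).
suff h_g : h = g by rewrite -(SinvK (g _)) -/(h (x k)) h_g.
have h_le t : h t <= g t.
  apply/S_mono; rewrite SinvK.
  by apply: (le_trans (g_convex _ _)); rewrite comp_subst_at.
(* Distributivity makes [T] and [S] commute with every operation, whence the convexity of [h]; the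
   value at [p] comes from [gTp]. *)
apply: g_min => //; split=> [beta y|t|]; last by rewrite /h gTp SK.
  apply/S_mono; rewrite SinvK /T omega_distr /S Omega_distr.
  apply: (le_trans (g_convex _ _)); apply: op_mono => j.
  by rewrite -/(S _) SinvK.
exact: le_trans (h_le t) (g_f t).
Qed.

End Minorants.
End Operations.

Theorem corollary4p4 (X : Type) (d : Order.disp_t) (Y : porderType d)
    (Gamma : Type) (n : Gamma -> nat)
    (omega : op_family n X) (Omega : op_family n Y)
    (X_nonempty : inhabited X) (Gamma_nonempty : inhabited Gamma)
    (n_pos : forall gamma : Gamma, (0 < n gamma)%N)
    (Y_complete : lower_chain_complete Y)
    (omega_refl : reflexive_ops omega)
    (omega_distr : mutually_distributive omega)
    (Omega_refl : reflexive_ops Omega)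
    (Omega_distr : mutually_distributive Omega)
    (Omega_aut : automorphism_in_each_variable Omega)
    (f : X -> Y) (f_convex : op_convex omega Omega f) :
  forall p : X, op_interior omega p ->
    exists g : X -> Y,
      op_affine omega Omega g /\ (forall x : X, (g x <= f x)%O) /\ g p = f p.
Proof.
move=> p p_int.
have [g g_minorant g_min] :=
  minimal_convex_minorant Omega_aut Y_complete f_convex p_int.
exists g; split; last by have [] := g_minorant.
exact: (minimal_convex_minorant_affine Omega_aut omega_refl omega_distr
  Omega_refl Omega_distr g_minorant g_min).
Qed.
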